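(* Let $V\subset\mathbb{R}^d$ be a non-empty, bounded, open set, let $v\in V$ and $0<r<1$. Let $X_r^v(\infty)$ be the almost sure limit, as $n\to\infty$, of the random sequence $(X_r^v(n))_{n\ge1}$ defined by $X_r^v(1)=v$ and $X_r^v(n+1)=X_r^v(n)+r\,d(X_r^v(n),\partial V)\,\vartheta_n$ for $n\ge1$. Then $X_r^v(\infty)\in\partial V$ almost surely.
   Context: $\mathbb{R}^d$ carries the Euclidean norm $\|\cdot\|$; $d(x,A)=\inf\{\|x-y\|:y\in A\}$. The random variables $\vartheta_1,\vartheta_2,\dots$ are defined on a common probability space $(\Omega,\mathcal{F},P)$ and are independent and identically distributed with uniform distribution on the unit sphere $S_1(0)=\{y\in\mathbb{R}^d:\|y\|=1\}$. The sequence $(X_r^v(n))_n$ takes values in $V$ and converges almost surely (each of its coordinates is a bounded martingale), so the limit $X_r^v(\infty)$ is defined almost surely. *)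

(* Defs.v *)
From HB Require Import structures.
From mathcomp Require Import all_boot all_order all_algebra.
From mathcomp Require Import finmap.
From mathcomp Require Import all_classical all_reals all_analysis.

Set Implicit Arguments.
Unset Strict Implicit.
Unset Printing Implicit Defensive.

Import Order.TTheory GRing.Theory Num.Theory.
Import numFieldNormedType.Exports.

Local Open Scope classical_set_scope.
Local Open Scope ring_scope.

(* The library norm [`|x|] on ['rV[R]_d] is the sup norm. It induces the same
   topology and the same bounded sets as the Euclidean norm, so [open],
   [closure], [bounded_set] and limits are the library's; the quantities that
   depend on the choice of the norm use [enorm]. *)
Definition enorm (R : realType) (d : nat) (x : 'rV[R]_d) : R :=
  Num.sqrt (\sum_(i < d) x ord0 i ^+ 2).

Definition edistance (R : realType) (d : nat) (x : 'rV[R]_d)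
    (A : set 'rV[R]_d) : R :=
  inf [set enorm (x - y) | y in A].

Definition unit_sphere (R : realType) (d : nat) : set 'rV[R]_d :=
  [set y | enorm y = 1].

Definition boundary (T : topologicalType) (A : set T) : set T :=
  closure A `\` interior A.

(* R^d with its Borel sigma-algebra *)
Definition borel_rV (R : realType) (d : nat) :=
  g_sigma_algebraType [set A : set 'rV[R]_d | open A].

(* The uniform distribution on the unit sphere is the only probability measure
   carried by the sphere and invariant under the orthogonal group O(d). *)
Definition uniform_on_sphere (R : realType) (d : nat)
    (mu : probability (borel_rV R d) R) : Prop :=
  mu (@unit_sphere R d) = 1%E /\
  forall Q : 'M[R]_d, Q *m Q^T = 1%:M ->
  forall A : set (borel_rV R d), measurable A ->
    mu [set x : 'rV[R]_d | A (x *m Q)] = mu A.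

Definition mutually_independent (disp : measure_display)
    (Omega : measurableType disp) (R : realType) (P : probability Omega R)
    (disp' : measure_display) (T : measurableType disp')
    (X : nat -> {RV P >-> T}) : Prop :=
  forall (J : {fset nat}) (A : nat -> set T),
    (forall i, i \in J -> measurable (A i)) ->
    P (\bigcap_(i in [set` J]) (X i @^-1` A i)) =
    (\prod_(i <- J) P (X i @^-1` A i))%E.

(* Indices are shifted by one: [walk V r v theta n] is X_r^v(n+1), and
   [theta n] is the random direction of index n+1. *)
Fixpoint walk (R : realType) (d : nat) (Omega : Type) (V : set 'rV[R]_d)
    (r : R) (v : 'rV[R]_d) (theta : nat -> Omega -> 'rV[R]_d) (n : nat)
    (w : Omega) : 'rV[R]_d :=
  match n with
  | 0 => v
  | m.+1 => let x := walk V r v theta m w in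
            x + (r * edistance x (boundary V)) *: theta m w
  end.

(* [lim] is total: this is meaningful only where the sequence converges. *)
Definition walk_limit (R : realType) (d : nat) (Omega : Type)
    (V : set 'rV[R]_d) (r : R) (v : 'rV[R]_d)
    (theta : nat -> Omega -> 'rV[R]_d) (w : Omega) : 'rV[R]_d :=
  lim (walk V r v theta n w @[n --> \oo]).

(* Main.v *)
(** Replace the directions, off the null set where they leave the sphere, by 0;
    then the walk stays in [V] everywhere. The direction of index n is symmetric
    and independent of the first n ones, so each coordinate of the walk is a
    bounded martingale. Its increments are orthogonal in L^2, and the L^2
    maximal inequality makes it almost surely Cauchy. Where the walk converges,
    its increments, of length [r * d(X_n, boundary V)], tend to 0; hence so does
    the distance to the boundary, and the limit lies on this closed set. *)

Require Import Defs.
From HB Require Import structures.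
From mathcomp Require Import all_boot all_order all_algebra.
From mathcomp Require Import finmap.
From mathcomp Require Import all_classical all_reals all_analysis.
From mathcomp Require Import measurable_realfun.
From mathcomp Require Import ring.

Set Implicit Arguments.
Unset Strict Implicit.
Unset Printing Implicit Defensive.

Import Order.TTheory GRing.Theory Num.Theory.
Import numFieldNormedType.Exports.

Local Open Scope classical_set_scope.
Local Open Scope ring_scope.

(** * Almost sure convergence of bounded martingales *)

Section generated_sub_sigma_algebra.
Context d d' (Omega : measurableType d) (T : measurableType d').
Implicit Types (G H : set (set Omega)) (f : Omega -> T).

(** A sub-sigma-algebra is given by a generating family [G], and measurability with respect to it is
    measurability on the domain retyped as [g_sigma_algebraType G]. Adaptedness to a filtration is
    expressed in this way below. *)
Lemma g_sigma_measurable_fun G f : G `<=` measurable ->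
  measurable_fun setT (f : g_sigma_algebraType G -> T) ->
  measurable_fun setT f.
Proof.
move=> mG mf _ Y mY.
have : <<s G >> (setT `&` f @^-1` Y) by exact: mf.
apply: smallest_sub mG _; split; [exact: measurable0| |].
  by move=> B mB; exact: measurableD.
exact: bigcupT_measurable.
Qed.

Lemma g_sigma_measurable_fun_le G H f : G `<=` H ->
  measurable_fun setT (f : g_sigma_algebraType G -> T) ->
  measurable_fun setT (f : g_sigma_algebraType H -> T).
Proof.
move=> GH mf _ Y mY.
have : <<s G >> (setT `&` f @^-1` Y) by exact: mf.
exact: sub_sigma_algebra2.
Qed.

End generated_sub_sigma_algebra.

Section bounded_martingale.
Context (R : realType) (disp : measure_display) (Omega : measurableType disp)
  (P : probability Omega R).

(** These functions form a ring inside L^1 of any probability, so every integrability condition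
    below reduces to closure under sums and products. *)
Definition bdd_measurable (f : Omega -> R) :=
  measurable_fun setT f /\ exists C, forall w, `|f w| <= C.

Lemma bdd_measurableD f g : bdd_measurable f -> bdd_measurable g ->
  bdd_measurable (fun w => f w + g w).
Proof.
move=> [mf [C fC]] [mg [D gD]]; split; first exact: measurable_funD.
by exists (C + D) => w; rewrite (le_trans (ler_normD _ _))// lerD.
Qed.

Lemma bdd_measurableN f : bdd_measurable f -> bdd_measurable (fun w => - f w).
Proof.
move=> [mf [C fC]]; split; first exact: measurableT_comp.
by exists C => w; rewrite normrN.
Qed.

Lemma bdd_measurableB f g : bdd_measurable f -> bdd_measurable g ->
  bdd_measurable (fun w => f w - g w).
Proof. by move=> mf /bdd_measurableN; exact: bdd_measurableD. Qed.

Lemma bdd_measurableM f g : bdd_measurable f -> bdd_measurable g ->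
  bdd_measurable (fun w => f w * g w).
Proof.
move=> [mf [C fC]] [mg [D gD]]; split; first exact: measurable_funM.
by exists (C * D) => w; rewrite normrM ler_pM.
Qed.

Lemma bdd_measurable_cst c : bdd_measurable (fun=> c).
Proof. by split; [exact: measurable_cst|exists `|c|]. Qed.

Lemma bdd_measurable_integrable f :
  bdd_measurable f -> P.-integrable setT (EFin \o f).
Proof.
move=> [mf [C fC]]; apply: measurable_bounded_integrable => //.
  by rewrite (le_lt_trans (probability_le1 P measurableT))// ltry.
exists C; split; first exact: num_real.
by move=> x Cx w _; exact: le_trans (fC w) (ltW Cx).
Qed.

Context (G : nat -> set (set Omega)) (M : nat -> Omega -> R) (C : R).
Hypothesis G_measurable : forall n, G n `<=` measurable.
Hypothesis G_nondecreasing : forall n, G n `<=` G n.+1.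
Hypothesis M_adapted : forall n,
  measurable_fun setT (M n : g_sigma_algebraType (G n) -> R).
Hypothesis M_bounded : forall n w, `|M n w| <= C.
(** The martingale property in weak form, with no conditional expectation: an increment is
    orthogonal to every bounded variable known before it. *)
Hypothesis M_orthogonal : forall n (U : Omega -> R),
  measurable_fun setT (U : g_sigma_algebraType (G n) -> R) ->
  (exists D : R, forall w, `|U w| <= D) ->
  \int[P]_w (U w * (M n.+1 w - M n w)) = 0.

Let adapted_measurable n d (T : measurableType d) (f : Omega -> T) :
  measurable_fun setT (f : g_sigma_algebraType (G n) -> T) ->
  measurable_fun setT f.
Proof. exact: g_sigma_measurable_fun. Qed.

Let adaptedS m k d (T : measurableType d) (f : Omega -> T) :
  measurable_fun setT (f : g_sigma_algebraType (G m) -> T) ->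
  measurable_fun setT (f : g_sigma_algebraType (G (m + k)) -> T).
Proof.
apply: g_sigma_measurable_fun_le; elim: k => [|k IH]; first by rewrite addn0.
by rewrite addnS; apply: subset_trans IH _.
Qed.

Let bM n : bdd_measurable (M n).
Proof.
split; last by exists C.
by apply: (@adapted_measurable n); exact: M_adapted.
Qed.

Let bounded (f : Omega -> R) := exists D : R, forall w, `|f w| <= D.

(** Split [M n.+1 - U] at [M n] and expand the square. The cross term is the increment times
    [2 * J * (M n - U)], a bounded variable known at time [n], so its integral vanishes. *)
Let pythagoras n (J U : Omega -> R) c :
  measurable_fun setT (J : g_sigma_algebraType (G n) -> R) -> bounded J ->
  measurable_fun setT (U : g_sigma_algebraType (G n) -> R) -> bounded U ->
  \int[P]_w (J w * ((M n.+1 w - U w) ^+ 2 - c)) =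
  \int[P]_w (J w * ((M n w - U w) ^+ 2 - c)) +
  \int[P]_w (J w * (M n.+1 w - M n w) ^+ 2).
Proof.
move=> mJ bJ mU bU.
have BJ : bdd_measurable J by split=> //; exact: adapted_measurable mJ.
have BU : bdd_measurable U by split=> //; exact: adapted_measurable mU.
pose W w := 2 * J w * (M n w - U w).
have BW : bdd_measurable W.
  apply: bdd_measurableM; last exact: bdd_measurableB.
  by apply: bdd_measurableM => //; exact: bdd_measurable_cst.
have orthW : \int[P]_w (W w * (M n.+1 w - M n w)) = 0.
  apply: M_orthogonal; last by case: BW.
  apply: measurable_funM; first by apply: measurable_funM.
  by apply: measurable_funB => //; exact: M_adapted.
have B1 : bdd_measurable (fun w => J w * ((M n w - U w) ^+ 2 - c)).
  apply: bdd_measurableM => //; apply: bdd_measurableB; last first.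
    exact: bdd_measurable_cst.
  by apply: bdd_measurableM; exact: bdd_measurableB.
have B2 : bdd_measurable (fun w => J w * (M n.+1 w - M n w) ^+ 2).
  apply: bdd_measurableM => //.
  by apply: bdd_measurableM; exact: bdd_measurableB.
have B3 : bdd_measurable (fun w => W w * (M n.+1 w - M n w)).
  by apply: bdd_measurableM => //; exact: bdd_measurableB.
(* The vanishing cross term is put back in place of 0, so that both sides become integrals of
   pointwise equal functions. *)
rewrite -[RHS]addr0 -orthW -!RintegralD//.
- by apply: eq_Rintegral => w _; rewrite /W; ring.
- exact/bdd_measurable_integrable/bdd_measurableD.
- exact: bdd_measurable_integrable.
- exact: bdd_measurable_integrable.
- exact: bdd_measurable_integrable.
Qed.

Let a n := \int[P]_w (M n w ^+ 2).

(** By induction on [k], with two uses of [pythagoras] for [J = 1]: around [M m] it isolates the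
    variance of the last increment, and around 0 it identifies this variance with a difference of
    consecutive values of [a]. *)
Let increment_variance m k :
  \int[P]_w ((M (m + k) w - M m w) ^+ 2) = a (m + k) - a m.
Proof.
elim: k => [|k IH].
  under eq_Rintegral do rewrite addn0 subrr expr0n.
  by rewrite Rintegral_cst// mul0r addn0 subrr.
have Mm : measurable_fun setT (M m : g_sigma_algebraType (G (m + k)) -> R).
  by apply: adaptedS; exact: M_adapted.
have bMm : bounded (M m) by exists C.
have b1 : bounded (cst 1) by exists 1 => w; rewrite normr1.
have b0 : bounded (cst 0) by exists 0 => w; rewrite normr0.
have := @pythagoras (m + k) _ _ 0 (measurable_cst (1 : R)) b1 Mm bMm.
have := @pythagoras (m + k) _ _ 0 (measurable_cst (1 : R)) b1
  (measurable_cst (0 : R)) b0.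
under eq_Rintegral do rewrite /cst mul1r !subr0.
under [X in _ = X + _ -> _]eq_Rintegral do rewrite /cst mul1r !subr0.
under [X in _ -> X = _ -> _]eq_Rintegral do rewrite /cst mul1r !subr0.
under [X in _ -> _ = X + _ -> _]eq_Rintegral do rewrite /cst mul1r !subr0.
rewrite -!/(a _) IH addnS => -> ->; ring.
Qed.

(** Recursive and boolean rather than existential: measurability and the step from [k] to [k.+1] in
    the maximal inequality then go by induction. *)
Let exceeds e m := fix exceeds k w : bool :=
  if k is k'.+1 then exceeds k' w || (e <= `|M (m + k) w - M m w|) else false.

Let exceedsP e m k w : reflect
  (exists2 i, (0 < i <= k)%N & e <= `|M (m + i) w - M m w|) (exceeds e m k w).
Proof.
apply: (iffP idP).
  elim: k => //= k IH /orP[/IH[i /andP[i0 ik] ei]|ei].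
    by exists i => //; rewrite i0 leqW.
  by exists k.+1 => //; rewrite leqnn.
elim: k => [|k IH] [i] /andP[i0]; first by case: i i0.
rewrite leq_eqVlt /= => /orP[/eqP-> ->|ik ei]; first by rewrite orbT.
by rewrite IH//; exists i => //; rewrite i0.
Qed.

Let measurable_exceeds e m k :
  measurable_fun setT (exceeds e m k : g_sigma_algebraType (G (m + k)) -> bool).
Proof.
elim: k => [|k IH]; first exact: measurable_cst.
apply: measurable_or; first by rewrite addnS -addn1; exact: adaptedS.
apply: measurable_fun_ler; first exact: measurable_cst.
apply: measurableT_comp => //; apply: measurable_funB; first exact: M_adapted.
by apply: adaptedS; exact: M_adapted.
Qed.

Let measurable_exceeded e m k : measurable [set w | exceeds e m k w].
Proof.
have mE := adapted_measurable (@measurable_exceeds e m k).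
by have := mE measurableT [set true] I; rewrite setTI.
Qed.

Let J e m k w : R := if exceeds e m k w then 1 else 0.

Let measurable_J e m k :
  measurable_fun setT (J e m k : g_sigma_algebraType (G (m + k)) -> R).
Proof. by apply: measurable_fun_ifT. Qed.

Let bounded_J e m k : bounded (J e m k).
Proof.
by exists 1 => w; rewrite /J; case: ifP => _; rewrite ?normr1 ?normr0.
Qed.

Let bJ e m k : bdd_measurable (J e m k).
Proof.
split; last exact: bounded_J.
exact: (adapted_measurable (@measurable_J e m k)).
Qed.

(* Going from k to k + 1, orthogonality makes the integral over the old event
   grow, and on the newly added outcomes the integrand is nonnegative. *)
Let maximal_aux e m k : 0 <= e ->
  0 <= \int[P]_w (J e m k w * ((M (m + k) w - M m w) ^+ 2 - e ^+ 2)).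
Proof.
move=> e0; elim: k => [|k IH].
  by apply: Rintegral_ge0 => w _; rewrite /J /= mul0r.
apply: (@le_trans _ _
    (\int[P]_w (J e m k w * ((M (m + k).+1 w - M m w) ^+ 2 - e ^+ 2)))).
  have Mm : measurable_fun setT (M m : g_sigma_algebraType (G (m + k)) -> R).
    by apply: adaptedS; exact: M_adapted.
  have bMm : bounded (M m) by exists C.
  rewrite (pythagoras _ (@measurable_J e m k) (@bounded_J e m k) Mm bMm).
  rewrite addr_ge0//; apply: Rintegral_ge0 => w _.
  by rewrite mulr_ge0 ?sqr_ge0// /J; case: ifP.
rewrite addnS; apply: le_Rintegral => //.
- apply/bdd_measurable_integrable/bdd_measurableM => //.
  apply: bdd_measurableB; last exact: bdd_measurable_cst.
  by apply: bdd_measurableM; exact: bdd_measurableB.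
- apply/bdd_measurable_integrable/bdd_measurableM => //.
  apply: bdd_measurableB; last exact: bdd_measurable_cst.
  by apply: bdd_measurableM; exact: bdd_measurableB.
- move=> w _; rewrite /J /=; case: (exceeds e m k w) => //=.
  case: ifP => [eM|_]; rewrite mul0r // mul1r subr_ge0.
  by rewrite -[leRHS]real_normK ?num_real// lerXn2r// ?nnegrE// -addnS.
Qed.

(** The maximal inequality of Kolmogorov. By [maximal_aux], the left side is at most the integral of
    the squared increment over the event, hence at most its integral over the whole space. *)
Let maximal e m k : 0 <= e ->
  e ^+ 2 * fine (P [set w | exceeds e m k w]) <= a (m + k) - a m.
Proof.
move=> e0.
have -> : fine (P [set w | exceeds e m k w]) = \int[P]_w J e m k w.
  rewrite /Rintegral -[in LHS](setIT [set w | _]) -integral_indic//.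
  congr fine; apply: eq_integral => w _; rewrite /J indicE.
  by case: ifPn => [E|/negP E]; [rewrite mem_set|rewrite memNset].
rewrite -increment_variance -RintegralZl//; last first.
  exact: bdd_measurable_integrable.
have BX : bdd_measurable (fun w => (M (m + k) w - M m w) ^+ 2).
  by apply: bdd_measurableM; exact: bdd_measurableB.
have BeJ : bdd_measurable (fun w => e ^+ 2 * J e m k w).
  by apply: bdd_measurableM => //; exact: bdd_measurable_cst.
rewrite -subr_ge0 -RintegralB//; [|exact: bdd_measurable_integrable..].
apply: le_trans (maximal_aux m k e0) _; apply: le_Rintegral => //.
- apply/bdd_measurable_integrable/bdd_measurableM => //.
  by apply: bdd_measurableB => //; exact: bdd_measurable_cst.
- exact/bdd_measurable_integrable/bdd_measurableB.
- move=> w _; rewrite /J; case: ifP => _; rewrite ?mul1r ?mulr1// mul0r mulr0.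
  by rewrite subr0 sqr_ge0.
Qed.

(** Failure of the Cauchy criterion at scale [e]. *)
Let escape e := [set w | forall m, exists k, e <= `|M (m + k) w - M m w|].

Let a_le n : a n <= C ^+ 2.
Proof.
have -> : C ^+ 2 = \int[P]_w (C ^+ 2).
  by rewrite Rintegral_cst// [X in fine X]probability_setT mulr1.
apply: le_Rintegral => //.
- exact/bdd_measurable_integrable/bdd_measurableM.
- exact/bdd_measurable_integrable/bdd_measurable_cst.
- move=> w _; rewrite -[leLHS]real_normK ?num_real// lerXn2r ?nnegrE//.
  exact: le_trans (M_bounded n w).
Qed.

(** The second moments are bounded, and by [maximal] they never decrease. For [m] with [a m] near
    their supremum, the maximal inequality makes an excursion of size [e] after [m] improbable,
    uniformly in the horizon [k]; continuity from below removes the horizon. *)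
Let escape_negligible e : 0 < e -> P.-negligible (escape e).
Proof.
move=> e0.
have a_ub : has_ubound (range a) by exists (C ^+ 2) => _ [n _ <-].
have a_sup : has_sup (range a) by split => //; exists (a 0); exists 0.
pose E m := \bigcup_k [set w | exceeds e m k w].
have mE m : measurable (E m) by apply: bigcupT_measurable.
exists (\bigcap_m E m); split.
- exact: bigcapT_measurable.
- apply/eqP; rewrite -measure_le0; apply/lee_addgt0Pr => d d0.
  (* The margin [e ^+ 2 * d] becomes [d] once the factor [e ^+ 2] of the maximal inequality is
     cancelled. *)
  have [_ [m _ <-]] := sup_adherent (mulr_gt0 (exprn_gt0 2 e0) d0) a_sup.
  rewrite ltrBlDl => am; rewrite add0e.
  apply: (@le_trans _ _ (P (E m))).
    by rewrite le_measure ?inE//; [exact: bigcapT_measurable|exact: bigcap_inf].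
  have cvE : P [set w | exceeds e m k w] @[k --> \oo] --> P (E m).
    apply: nondecreasing_cvg_mu => //; first exact: mE.
    move=> i j ij; apply/subsetPset => w /=.
    move=> /exceedsP[l /andP[l0 li] el]; apply/exceedsP; exists l => //.
    by rewrite l0 (leq_trans li).
  rewrite -(cvg_lim _ cvE)//; apply: lime_le; first exact: cvgP cvE.
  near=> k; rewrite -[leLHS]fineK ?fin_num_measure// lee_fin.
  rewrite -(ler_pM2l (exprn_gt0 2 e0)) (le_trans (maximal _ _ (ltW e0)))//.
  rewrite lerBlDr (le_trans (ub_le_sup a_ub (imageT _ _)))//.
  exact: ltW.
(* The event [exceeds] starts at offset 1, whereas [escape] allows offset 0; there the increment is
   0, which [0 < e] excludes. *)
- move=> w ew m _; have [k ek] := ew m; exists k => //=; apply/exceedsP.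
  exists k => //; rewrite leqnn andbT lt0n; apply: contraTneq ek => ->.
  by rewrite addn0 subrr normr0 -ltNge.
Unshelve. all: by end_near. Qed.

(** Outside the countable union of the sets [escape k.+1%:R^-1] the path is Cauchy, and [R] is
    complete. *)
Lemma bounded_martingale_cvg : {ae P, forall w, cvg (M n w @[n --> \oo])}.
Proof.
apply: negligibleS (negligible_bigcup
  (fun k => @escape_negligible k.+1%:R^-1 _)) => //.
move=> w /= ncvg; apply: contrapT => nesc; apply: ncvg.
apply/cauchy_cvgP/cauchy_exP => e e0.
pose k := Num.truncn e^-1.
have ke : k.+1%:R^-1 < e.
  by rewrite invf_plt ?posrE// truncnS_gt.
have [m Hm] : exists m, forall i, `|M (m + i) w - M m w| < k.+1%:R^-1.
  apply: contrapT => /forallNP H; apply: nesc; exists k => // m.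
  by have /existsNP[i /negP] := H m; rewrite -leNgt; exists i.
exists (M m w); exists m => // n /= mn.
by rewrite -ball_normE /= distrC -(subnKC mn) (lt_trans (Hm _)).
Qed.

End bounded_martingale.

(** * Symmetric independent noise *)

Section symmetric_noise.
Context (R : realType) (disp : measure_display) (Omega : measurableType disp)
  (P : probability Omega R) (disp' : measure_display)
  (T : measurableType disp') (X : nat -> {RV P >-> T}).
Hypothesis X_indep : mutually_independent X.

(** Only the pi-system of cylinder events is recorded, not the sigma-algebra it generates, so that
    uniqueness of measures applies to it directly. *)
Definition past n : set (set Omega) :=
  [set B | exists A : nat -> set T, (forall i, measurable (A i)) /\
    B = \bigcap_(i in [set i | (i < n)%N]) (X i @^-1` A i)].

Lemma past_setI_closed n : setI_closed (past n).
Proof.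
move=> _ _ [A [mA ->]] [B [mB ->]]; exists (fun i => A i `&` B i).
split; first by move=> i; exact: measurableI.
by rewrite -bigcapI.
Qed.

Lemma past_measurable n : past n `<=` measurable.
Proof.
move=> _ [A [mA ->]]; apply: bigcap_measurableType => i _.
exact: measurable_funPTI.
Qed.

Lemma past_nondecreasing n : past n `<=` past n.+1.
Proof.
move=> _ [A [mA ->]]; exists (fun i => if (i < n)%N then A i else setT).
split; first by move=> i; case: ifP.
apply/seteqP; split=> w Hw i /= ni.
  by case: ifP => // ni'; exact: Hw.
by have := Hw i (ltnW ni); rewrite ni.
Qed.

Lemma past_preimage n i C : (i < n)%N -> measurable C ->
  past n (X i @^-1` C).
Proof.
move=> ni mC; exists (fun j => if j == i then C else setT).
split; first by move=> j; case: ifP.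
apply/seteqP; split=> w Hw; first by move=> j /= jn; case: eqP => // ->.
by have := Hw i ni; rewrite eqxx.
Qed.

Let past_independent n B C : past n B -> measurable C ->
  (P (B `&` X n @^-1` C) = P B * P (X n @^-1` C))%E.
Proof.
move=> [A [mA ->]] mC.
pose J := [fset i in iota 0 n]%fset.
have J_n : [set i | (i < n)%N] = [set` J].
  by apply/seteqP; split=> i /=; rewrite !inE mem_iota.
(* The family [A'] carries [C] at index [n] and [A] below it. Mutual independence is used over [J]
   with [n] added, then over [J] alone, to recover the probability of the past event. *)
have nJ : n \notin J by rewrite !inE mem_iota ltnn.
pose A' i := if i == n then C else A i.
have mA' i : measurable (A' i) by rewrite /A'; case: ifP.
have A'J i : i \in J -> A' i = A i.
  by rewrite /A' => iJ; case: eqP => // iE; move: nJ; rewrite -iE iJ.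
have := @X_indep (n |` J)%fset A' (fun i _ => mA' i).
rewrite big_fsetU1 //= {2}/A' eqxx.
rewrite set_fsetU1 bigcap_setU bigcap_set1 {1}/A' eqxx setIC J_n.
have <- : \bigcap_(i in [set` J]) (X i @^-1` A' i) =
    \bigcap_(i in [set` J]) (X i @^-1` A i).
  by apply: eq_bigcapr => i iJ; rewrite A'J.
move=> ->; rewrite muleC; congr (_ * _)%E.
by rewrite X_indep.
Qed.

(** As functions of [B], both sides are finite measures that agree on the pi-system [past n], hence
    on the sigma-algebra it generates. *)
Lemma past_sigma_independent n B C : <<s past n >> B -> measurable C ->
  (P (B `&` X n @^-1` C) = P B * P (X n @^-1` C))%E.
Proof.
move=> sB mC; have mXC : measurable (X n @^-1` C) by exact: measurable_funPTI.
pose p : {nonneg R} := NngNum (fine_ge0 (measure_ge0 P (X n @^-1` C))).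
have pE : p%:num%:E = P (X n @^-1` C) by rewrite /= fineK ?fin_num_measure.
rewrite muleC -pE.
have := @g_sigma_algebra_measure_unique _ _ _ (past n) (@past_measurable n)
  (fun=> setT) _ _ (mrestr P mXC) (mscale p P).
apply => //.
- by move=> _; exists (fun=> setT); split=> //; apply/seteqP; split.
- by rewrite bigcup_const.
- exact: past_setI_closed.
- move=> A pA; transitivity (P A * P (X n @^-1` C))%E.
    exact: past_independent.
  by rewrite -pE muleC.
- by move=> _; rewrite /mrestr -ge0_fin_numE//= fin_num_measure// setTI.
Qed.

(* The pairs [(U, h (X n))] and [(U, - h (X n))] have the same law, so the
   integral is equal to its opposite. *)
Lemma symmetric_noise_orthogonal n (U : Omega -> R) (h : T -> R) :
  measurable_fun setT (U : g_sigma_algebraType (past n) -> R) ->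
  measurable_fun setT h ->
  (forall B : set R, measurable B ->
    P (X n @^-1` (h @^-1` B)) = P (X n @^-1` ((fun x => - h x) @^-1` B))) ->
  (exists C : R, forall w, `|U w * h (X n w)| <= C) ->
  \int[P]_w (U w * h (X n w)) = 0.
Proof.
move=> sU mh h_sym Uh_bdd.
have mU : measurable_fun setT U.
  by apply: g_sigma_measurable_fun sU; exact: past_measurable.
have mhX : measurable_fun setT (fun w => h (X n w)) by exact: measurableT_comp.
pose f1 w : (R * R)%type := (U w, h (X n w)).
pose f2 w : (R * R)%type := (U w, - h (X n w)).
have mf1 : measurable_fun setT f1 by exact: measurable_fun_pair.
have mf2 : measurable_fun setT f2.
  by apply: measurable_fun_pair => //; exact: measurableT_comp.
pose F1 : {mfun Omega >-> (R * R)%type} :=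
  HB.pack f1 (isMeasurableFun.Build _ _ _ _ _ mf1).
pose F2 : {mfun Omega >-> (R * R)%type} :=
  HB.pack f2 (isMeasurableFun.Build _ _ _ _ _ mf2).
(* It suffices to compare the laws on rectangles, a generating pi-system. There independence factors
   the probability, and the symmetry of [h (X n)] changes the second factor. *)
have eq_law A : measurable A -> pushforward P F1 A = pushforward P F2 A.
  apply: (measure_unique [set A `*` B | A in measurable & B in measurable]
    (fun=> setT)).
  - by rewrite measurable_prod_measurableType.
  - move=> _ _ [A1 mA1 [B1 mB1 <-]] [A2 mA2 [B2 mB2 <-]].
    exists (A1 `&` A2); first exact: measurableI.
    by exists (B1 `&` B2); [exact: measurableI|rewrite setXI].
  - by move=> _; exists setT => //; exists setT => //; rewrite setXTT.
  - by rewrite bigcup_const.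
  - move=> _ [B mB [D mD <-]]; rewrite /pushforward.
    have sB : <<s past n >> (U @^-1` B).
      by rewrite -[X in <<s _ >> X]setTI; exact: sU.
    have mhD : measurable (h @^-1` D).
      by rewrite -[X in measurable X]setTI; exact: mh.
    have mhND : measurable ((fun x => - h x) @^-1` D).
      by rewrite -[X in measurable X]setTI; apply: measurableT_comp.
    transitivity (P (U @^-1` B `&` X n @^-1` (h @^-1` D))) => //.
    rewrite past_sigma_independent// h_sym// -past_sigma_independent//.
  - move=> _; apply: (le_lt_trans (probability_le1 P measurableT)).
    exact: ltry.
pose g (y : (R * R)%type) : \bar R := (y.1 * y.2)%:E.
have mg : measurable_fun setT g.
  by apply/measurable_EFinP; exact: measurable_funM.
have BUh : bdd_measurable (fun w => U w * h (X n w)).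
  by split => //; exact: measurable_funM.
have i1 : P.-integrable setT (g \o F1) by exact: bdd_measurable_integrable.
have i2 : P.-integrable setT (g \o F2).
  have := bdd_measurable_integrable P (bdd_measurableN BUh).
  by apply: eq_integrable => // w _ /=; rewrite /g /= mulrN.
have : (\int[pushforward P F1]_y g y = \int[pushforward P F2]_y g y)%E.
  by apply: eq_measure_integral => A mA _; exact: eq_law.
rewrite !integral_pushforward// !preimage_setT => /(congr1 fine).
rewrite -/(Rintegral _ _ (fun w => U w * h (X n w))).
rewrite -/(Rintegral _ _ (fun w => U w * - h (X n w))).
have -> : \int[P]_w (U w * - h (X n w)) = - \int[P]_w (U w * h (X n w)).
  rewrite -mulN1r -RintegralZl//.
  by apply: eq_Rintegral => w _; rewrite mulN1r mulrN.
by move=> /eqP; rewrite -subr_eq0 opprK -mulr2n mulrn_eq0 => /eqP.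
Qed.

End symmetric_noise.

(** * Distance to the boundary of an open set *)

Lemma continuous_sum (R : realType) (T : topologicalType) (I : Type)
    (s : seq I) (F : I -> T -> R) :
  (forall i, continuous (F i)) -> continuous (fun y => \sum_(i <- s) F i y).
Proof.
move=> cF; elim: s => [|i s IH].
  rewrite (_ : (fun _ => _) = cst 0); first by move=> y; exact: cvg_cst.
  by apply/funext => y; rewrite big_nil.
rewrite (_ : (fun _ => _) = F i \+ (fun y => \sum_(i <- s) F i y)); last first.
  by apply/funext => y; rewrite big_cons.
by move=> y; apply: cvgD; [exact: cF|exact: IH].
Qed.

Section euclidean_geometry.
Context (R : realType) (d : nat).
Implicit Types (x y z : 'rV[R]_d) (A V B : set 'rV[R]_d).

Lemma enorm_ge0 x : 0 <= enorm x.
Proof. exact: sqrtr_ge0. Qed.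

Lemma enormZ c x : enorm (c *: x) = `|c| * enorm x.
Proof.
rewrite /enorm -sqrtr_sqr -sqrtrM ?sqr_ge0// mulr_sumr.
by congr Num.sqrt; apply: eq_bigr => i _; rewrite mxE exprMn.
Qed.

Lemma enormN x : enorm (- x) = enorm x.
Proof. by rewrite -scaleN1r enormZ normrN1 mul1r. Qed.

Lemma enorm0 : enorm (0 : 'rV[R]_d) = 0.
Proof. by rewrite -(scale0r (0 : 'rV[R]_d)) enormZ normr0 mul0r. Qed.

Lemma coord_le_enorm x i : `|x ord0 i| <= enorm x.
Proof.
rewrite -sqrtr_sqr ler_wsqrtr// (bigD1 i)//= lerDl.
by apply: sumr_ge0 => j _; exact: sqr_ge0.
Qed.

Lemma enormB_continuous y : continuous (fun x => enorm (x - y)).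
Proof.
have sqr_coord i :
    continuous (fun x : 'rV[R]_d => (x ord0 i - y ord0 i) ^+ 2 : R).
  have sqrB_continuous : continuous (fun t : R => (t - y ord0 i) ^+ 2).
    move=> t; have subc : {for t, continuous (fun t : R => t - y ord0 i)}.
      by apply: cvgB; [exact: cvg_id|exact: cvg_cst].
    exact: (continuous_comp subc (@exprn_continuous R 2 _)).
  move=> x; exact: (continuous_comp (@coord_continuous R 1 d ord0 i x)
    (sqrB_continuous _)).
rewrite (_ : (fun _ => _) =
    Num.sqrt \o (fun x => \sum_(i < d) (x ord0 i - y ord0 i) ^+ 2)).
  move=> x; apply: continuous_comp; last exact: sqrt_continuous.
  exact: continuous_sum.
apply/funext => x; congr Num.sqrt.
by apply: eq_bigr => i _; rewrite !mxE.
Qed.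

Lemma bounded_coord V : bounded_set V ->
  exists C, forall x, V x -> forall i, `|x ord0 i| <= C.
Proof.
move=> [M [_ VM]]; exists (M + 1) => x Vx i.
apply: le_trans (VM _ _ x Vx); last by rewrite ltrDl.
rewrite [leRHS]/Num.norm /= mx_normrE.
by apply/bigmax_geP; right => /=; exists (ord0, i).
Qed.

Lemma edistance_le x y B : B y -> edistance x B <= enorm (x - y).
Proof.
move=> By; apply: ge_inf; last by exists y.
by exists 0 => _ [z _ <-]; exact: enorm_ge0.
Qed.

Lemma edistance_ge0 x B : 0 <= edistance x B.
Proof.
(* The distance to the empty set is 0, the default value of [inf]. *)
have [->|/set0P B0] := eqVneq B set0.
  by rewrite /edistance image_set0 inf0.
apply: lb_le_inf; first by case: B0 => y By; exists (enorm (x - y)); exists y.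
by move=> _ [z _ <-]; exact: enorm_ge0.
Qed.

(** Strictness yields a witness even when the infimum is not attained. If [B] were empty, the
    default distance 0 could lie below [t] with no witness. *)
Lemma edistance_ltP x B t : B !=set0 ->
  edistance x B < t <-> exists2 y, B y & enorm (x - y) < t.
Proof.
move=> [y0 By0]; split; last first.
  by move=> [y By]; apply: le_lt_trans; exact: edistance_le.
move=> /inf_lt[|_ [y By <-] yt]; first by exists (enorm (x - y0)); exists y0.
by exists y.
Qed.

Lemma open_edistance_lt B t : B !=set0 -> open [set x | edistance x B < t].
Proof.
move=> B0; rewrite (_ : [set _ | _] =
    \bigcup_(y in B) ((fun x => enorm (x - y)) @^-1` [set s | s < t])).
  apply: bigcup_open => y _.
  apply: open_comp; last exact: open_lt.
  by move=> x _; exact: enormB_continuous.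
apply/seteqP; split => x /=.
  by move=> /(edistance_ltP _ _ B0)[y]; exists y.
by move=> [y By xyt]; apply/(edistance_ltP _ _ B0); exists y.
Qed.

Lemma boundary_closed V : closed (boundary V).
Proof.
rewrite /boundary setDE; apply: closedI; first exact: closed_closure.
exact/open_closedC/open_interior.
Qed.

(** If the segment avoided the boundary, the parameters sent into [V] would be both open and closed
    in the connected interval [0, 1]; containing 0, they would contain 1. *)
Lemma segment_meets_boundary V x u : open V -> V x -> ~ V (x + u) ->
  exists2 t, 0 <= t <= 1 & boundary V (x + t *: u).
Proof.
move=> oV Vx nVxu; apply: contrapT => noB.
pose g (t : R) := x + t *: u.
have gc : continuous g.
  by move=> t; apply: cvgD; [exact: cvg_cst|apply: cvgZr_tmp; exact: cvg_id].
have gE : `[0, 1] `&` g @^-1` V = `[0, 1]%classic.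
  apply: segment_connected.
  - exists 0; split; first by rewrite /= in_itv /= lexx ler01.
    by rewrite /= /g scale0r addr0.
  - by exists (g @^-1` V) => //; exact: open_comp.
  - exists (g @^-1` closure V).
      by apply: closed_comp => //; exact: closed_closure.
    apply/seteqP; split => t [t01 /= Vt]; split => //.
      exact: subset_closure.
    apply: contrapT => nVt; apply: noB.
    exists t; first by move: t01; rewrite /= in_itv.
    by split => // /interior_subset.
have : (`[0, 1] `&` g @^-1` V) 1 by rewrite gE /= in_itv /= ler01 lexx.
by rewrite /g => -[_ /=]; rewrite scale1r.
Qed.

(** A point with all coordinates [C + 1] lies outside [V] as soon as there is a coordinate, and the
    segment to it crosses the boundary. In dimension 0 the whole space is a bounded open set with
    empty boundary. *)
Lemma boundary_nonempty V : (0 < d)%N -> open V -> bounded_set V ->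
  V !=set0 -> boundary V !=set0.
Proof.
move=> d0 oV /bounded_coord[C VC] [x Vx].
have [|t _ Bt] := @segment_meets_boundary V x (const_mx (C + 1) - x) oV Vx.
  rewrite addrC subrK => /VC /(_ (Ordinal d0)); rewrite mxE.
  by move=> /(le_trans (ler_norm _)); rewrite gerDl ler10.
by exists (x + t *: (const_mx (C + 1) - x)).
Qed.

(** A step leaving [V] would cross the boundary at distance at most [r * D] from [x], where [D] is
    the distance to the boundary. Then [D <= r * D] forces [D = 0], so the step is null and does not
    leave [V]. *)
Lemma step_in_open V x s r : open V -> V x -> enorm s <= 1 -> 0 <= r < 1 ->
  V (x + (r * edistance x (boundary V)) *: s).
Proof.
move=> oV Vx s1 /andP[r0 r1]; apply: contrapT => nV.
have [t /andP[t0 t1] Bt] := segment_meets_boundary oV Vx nV.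
have := edistance_le x Bt.
rewrite opprD addrA subrr add0r enormN !enormZ (ger0_norm t0) normrM.
rewrite (ger0_norm r0) (ger0_norm (edistance_ge0 _ _)).
set D := edistance _ _ => Dle.
have D0 : 0 <= D by exact: edistance_ge0.
have : D <= r * D.
  apply: le_trans Dle _; rewrite -[leRHS]mul1r ler_pM ?mulr_ge0 ?enorm_ge0//.
  by rewrite ler_piMr// mulr_ge0.
rewrite -subr_ge0 -[X in _ - X]mul1r -mulrBl nmulr_rge0 ?subr_lt0// => D_le0.
have D_eq0 : D = 0 by apply/eqP; rewrite eq_le D_le0.
by apply: nV; rewrite -/D D_eq0 mulr0 scale0r addr0.
Qed.

Lemma edistance_cvg0_closed B (x : nat -> 'rV[R]_d) l :
  closed B -> B !=set0 -> x n @[n --> \oo] --> l ->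
  edistance (x n) B @[n --> \oo] --> 0 -> B l.
Proof.
move=> cB B0 xl xB; apply: cB => A /nbhs_ballP[e /= e0 eA].
have e2 : 0 < e / 2 by rewrite divr_gt0.
near \oo => n.
have /(edistance_ltP _ _ B0)[y By xy] : edistance (x n) B < e / 2.
  by near: n; exact: (cvgr_lt 0).
exists y; split => //; apply: eA; rewrite (splitr e).
apply: (ball_triangle (y := x n)); first by near: n; exact: (cvg_ball xl).
(* Balls are those of the sup norm, which the Euclidean norm dominates. *)
split => // i j; rewrite (ord1 i) -ball_normE /= -[X in X - _]opprK.
apply: le_lt_trans xy.
by have := coord_le_enorm (x n - y) j; rewrite !mxE opprK.
Unshelve. all: by end_near. Qed.

Lemma cvg_rV (x : nat -> 'rV[R]_d) :
  (forall i, cvg (x n ord0 i @[n --> \oo])) -> cvg (x n @[n --> \oo]).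
Proof.
move=> xc; apply/cvg_ex; exists (\row_i lim (x n ord0 i @[n --> \oo])).
apply/cvg_ballP => e e0.
have : \forall n \near \oo, forall i : 'I_d,
    ball (lim (x n ord0 i @[n --> \oo])) e (x n ord0 i).
  by apply: filter_forall => i; exact: (cvg_ball (xc i)).
by apply: filterS => n xn; split => // i j; rewrite (ord1 i) mxE; exact: xn.
Qed.

(** An open set is a countable union of boxes with rational centres and half-widths [k.+1%:R^-1],
    and the preimage of a box is a finite intersection of coordinate conditions. *)
Lemma measurable_open_preimage disp (T : measurableType disp)
    (f : T -> 'rV[R]_d) O :
  (forall i, measurable_fun setT (fun w => f w ord0 i)) -> open O ->
  measurable (f @^-1` O).
Proof.
move=> mf oO.
pose box (qk : 'rV[rat]_d * nat) : set 'rV[R]_d :=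
  [set x | forall i, `|ratr (qk.1 ord0 i) - x ord0 i| < qk.2.+1%:R^-1].
have boxE x qk : box qk x -> box qk `<=` ball x (2 * qk.2.+1%:R^-1).
  move=> bx y /= qy; split; first by rewrite mulr_gt0// invr_gt0.
  move=> i j; rewrite (ord1 i) mulr_natl mulr2n.
  apply: (@ball_triangle _ R (ratr (qk.1 ord0 j))).
    by apply: ball_sym; rewrite -ball_normE; exact: bx.
  by rewrite -ball_normE; exact: qy.
have -> : f @^-1` O = \bigcup_(qk : 'rV[rat]_d * nat)
    [set w | box qk `<=` O /\ box qk (f w)].
  apply/seteqP; split => w /=; last by move=> [qk _ [bO /bO]].
  move=> Ofw; have /nbhs_ballP[e /= e0 eO] := open_nbhs_nbhs (conj oO Ofw).
  (* Two points of a box differ by less than twice its half-width in each coordinate, hence the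
     factor 2. *)
  pose k := Num.truncn (2 / e).
  have ke : 2 * k.+1%:R^-1 < e.
    by rewrite ltr_pdivrMr// mulrC -ltr_pdivrMr// truncnS_gt.
  have /choice[q qf] : forall i, exists q : rat,
      `|ratr q - f w ord0 i| < k.+1%:R^-1.
    move=> i.
    have [|q] := @rat_in_itvoo R (f w ord0 i) (f w ord0 i + k.+1%:R^-1).
      by rewrite ltrDl invr_gt0.
    rewrite in_itv /= => /andP[q1 q2]; exists q.
    rewrite ltr_distl (lt_le_trans q2)// andbT ltrBlDr (lt_trans q1)//.
    by rewrite ltrDl invr_gt0.
  have bq : box (\row_i q i, k) (f w) by move=> i; rewrite mxE.
  exists (\row_i q i, k) => //; split=> //.
  apply: subset_trans eO; apply: subset_trans (boxE _ _ bq) _.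
  exact/le_ball/ltW.
apply: countable_bigcupT_measurable => // qk.
have [bO|nbO] := pselect (box qk `<=` O); last first.
  by rewrite (_ : [set _ | _] = set0)// -subset0 => w [].
rewrite (_ : [set _ | _] =
    \bigcap_(i in [set: 'I_d])
      [set w | `|ratr (qk.1 ord0 i) - f w ord0 i| < qk.2.+1%:R^-1]).
  apply: fin_bigcap_measurable => // i _.
  rewrite -[X in measurable X]setTI.
  apply: (@measurable_fun_ltr _ _ _ _ (fun=> _) _ _ _ measurableT [set true])
    => //.
  by apply: measurableT_comp => //; exact: measurable_funB.
apply/seteqP; split=> w /= => [[_ H] i _|H]; first exact: H.
by split=> // i; exact: H.
Qed.

(** Open half-lines generate the Borel sets of [R], and the sublevel sets of the distance are
    open. *)
Lemma measurable_edistance disp (T : measurableType disp)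
    (f : T -> 'rV[R]_d) B :
  (forall i, measurable_fun setT (fun w => f w ord0 i)) -> B !=set0 ->
  measurable_fun setT (fun w => edistance (f w) B).
Proof.
move=> mf B0; apply: (measurability _ (RGenInftyO.measurableE R)).
move=> _ [_ [t ->] <-]; rewrite setTI.
have := measurable_open_preimage mf (@open_edistance_lt B t B0).
by congr measurable; apply/seteqP; split=> w /=; rewrite in_itv.
Qed.

End euclidean_geometry.

(** * The random walk *)

Section walk_of_directions.
Context (R : realType) (d : nat) (Omega : Type) (V : set 'rV[R]_d) (r : R)
  (v : 'rV[R]_d) (theta : nat -> Omega -> 'rV[R]_d).

Lemma walk_in_open n w : open V -> V v -> 0 <= r < 1 ->
  (forall m, enorm (theta m w) <= 1) -> V (walk V r v theta n w).
Proof. by move=> oV Vv r01 th1; elim: n => //= n IH; exact: step_in_open. Qed.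

Lemma walk_limit_boundary w : boundary V !=set0 -> 0 < r ->
  (forall n, enorm (theta n w) = 1) ->
  cvg (walk V r v theta n w @[n --> \oo]) ->
  boundary V (walk_limit V r v theta w).
Proof.
move=> B0 r0 th1 xc; pose x n := walk V r v theta n w.
apply: (@edistance_cvg0_closed R d _ x) => //; first exact: boundary_closed.
(* The subtraction of 0 gives the shape required by [enormB_continuous]. *)
have dE n : edistance (x n) (boundary V) = r^-1 * enorm (x n.+1 - x n - 0).
  rewrite subr0 /= addrAC subrr add0r enormZ th1 mulr1.
  rewrite ger0_norm ?mulKf ?gt_eqF//.
  by rewrite mulr_ge0 ?edistance_ge0// ltW.
under eq_fun do rewrite dE.
rewrite -(mulr0 r^-1); apply: cvgM; first exact: cvg_cst.
have -> : (0 : R) = enorm (0 - 0 : 'rV[R]_d) by rewrite subr0 enorm0.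
apply: (cvg_comp (fun n => x n.+1 - x n) (fun y => enorm (y - 0)) _
  (@enormB_continuous R d 0 0)).
rewrite -(subrr (lim (x n @[n --> \oo]))); apply: cvgB => //.
by rewrite (@cvg_shiftS _ x).
Qed.

End walk_of_directions.

(** * Measurability and symmetry of uniform directions *)

Section uniform_directions.
Context (R : realType) (d : nat).

Lemma open_borel (A : set 'rV[R]_d) :
  open A -> measurable (A : set (borel_rV R d)).
Proof. exact: sub_sigma_algebra. Qed.

Lemma unit_sphere_borel : measurable (@unit_sphere R d : set (borel_rV R d)).
Proof.
rewrite -[X in measurable X]setCK; apply: measurableC; apply: open_borel.
rewrite openC (_ : @unit_sphere R d =
    (fun x : 'rV[R]_d => enorm (x - 0)) @^-1` [set 1]).
  apply: closed_comp => [x _|]; first exact: enormB_continuous.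
  exact: closed_eq.
by apply/seteqP; split => x /=; rewrite subr0.
Qed.

Lemma measurable_coord i :
  measurable_fun setT (fun x : borel_rV R d => x ord0 i : R).
Proof.
apply: (measurability _ (RGenOpens.measurableE R)).
move=> _ [_ [a [b ->]] <-]; rewrite setTI; apply: open_borel.
apply: open_comp; last exact: interval_open.
by move=> x _; exact: coord_continuous.
Qed.

(** The value 0 off the sphere keeps the map odd, so that it transports the symmetry of the law, and
    bounds its norm by 1 everywhere. *)
Definition sphere_part (x : 'rV[R]_d) : 'rV[R]_d :=
  if enorm x == 1 then x else 0.

Lemma enorm_sphere_part_le1 x : enorm (sphere_part x) <= 1.
Proof. by rewrite /sphere_part; case: eqP => [->|_] //; rewrite enorm0. Qed.

Lemma sphere_partN x : sphere_part (- x) = - sphere_part x.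
Proof. by rewrite /sphere_part enormN; case: ifP => // _; rewrite oppr0. Qed.

Lemma measurable_sphere_part i :
  measurable_fun setT (fun x : borel_rV R d => sphere_part x ord0 i : R).
Proof.
rewrite (_ : (fun _ => _) =
  (fun x : borel_rV R d => if enorm x == 1 then x ord0 i else 0)).
  apply: measurable_fun_ifT; [|exact: measurable_coord|exact: measurable_cst].
  apply: (measurable_fun_bool true); rewrite setTI.
  rewrite (_ : _ @^-1` _ = @unit_sphere R d); first exact: unit_sphere_borel.
  by apply/seteqP; split => x /eqP.
by apply/funext => x; rewrite /sphere_part; case: ifP => // _; rewrite mxE.
Qed.

(** Invariance is applied to the orthogonal matrix [- 1%:M], and [sphere_part] is odd. *)
Lemma uniform_sphere_part_symmetric (mu : probability (borel_rV R d) R) i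
    (B : set R) : uniform_on_sphere mu -> measurable B ->
  mu [set x | B (sphere_part x ord0 i)] =
  mu [set x | B (- sphere_part x ord0 i)].
Proof.
move=> [_ mu_inv] mB; rewrite -[LHS](mu_inv (- 1%:M)).
- congr (mu _); apply/seteqP; split=> x /=;
    by rewrite mulmxN mulmx1 sphere_partN mxE.
- by rewrite linearN /= trmx1 mulNmx mulmxN mulmx1 opprK.
- have := @measurable_sphere_part i measurableT B mB; rewrite setTI; exact.
Qed.

(** In dimension 0 the unit sphere is empty and cannot have mass 1. *)
Lemma uniform_dim_gt0 (mu : probability (borel_rV R d) R) :
  uniform_on_sphere mu -> (0 < d)%N.
Proof.
move=> [mu1 _]; rewrite lt0n; apply/eqP => d0.
have S0 : @unit_sphere R d = set0.
  rewrite -subset0 => x; rewrite /unit_sphere /= /enorm big1 ?sqrtr0.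
    by move=> /esym/eqP; rewrite oner_eq0.
  by move=> [i id] _; exfalso; move: id; rewrite d0.
by move: mu1; rewrite S0 measure0 => /esym/eqP; rewrite onee_eq0.
Qed.

End uniform_directions.

(** * Convergence of the walk to a boundary point *)

Theorem proposition2p4 (R : realType) (d : nat)
    (disp : measure_display) (Omega : measurableType disp)
    (P : probability Omega R)
    (mu : probability (borel_rV R d) R) (mu_uniform : uniform_on_sphere mu)
    (theta : nat -> {RV P >-> borel_rV R d})
    (theta_indep : mutually_independent theta)
    (theta_law : forall (n : nat) (A : set (borel_rV R d)),
       measurable A -> distribution P (theta n) A = mu A)
    (V : set 'rV[R]_d) (V_nonempty : V !=set0) (V_bounded : bounded_set V)
    (V_open : open V)
    (v : 'rV[R]_d) (v_in_V : V v)
    (r : R) (r_gt0 : 0 < r) (r_lt1 : r < 1) :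
  {ae P, forall w : Omega,
    cvg (walk V r v (fun n => theta n : Omega -> 'rV[R]_d) n w @[n --> \oo]) /\
    boundary V (walk_limit V r v (fun n => theta n : Omega -> 'rV[R]_d) w)}.
Proof.
have d_gt0 := uniform_dim_gt0 mu_uniform.
have B0 : boundary V !=set0 by exact: boundary_nonempty.
have law n A : measurable A -> P (theta n @^-1` A) = mu A by exact: theta_law.
pose th n (w : Omega) : 'rV[R]_d := sphere_part (theta n w : 'rV[R]_d).
pose X n w := walk V r v th n w.
have XV n w : V (X n w).
  apply: walk_in_open => //; first by rewrite (ltW r_gt0).
  by move=> m; exact: enorm_sphere_part_le1.
have [C VC] := bounded_coord V_bounded.
(* [X n] uses the directions of index below [n] only, which is what [past theta n] records. *)
have X_adapted n i : measurable_fun setT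
    ((fun w => X n w ord0 i) : g_sigma_algebraType (past theta n) -> R).
  elim: n i => [|n IH] i; first exact: measurable_cst.
  have mX j : measurable_fun setT
      ((fun w => X n w ord0 j) : g_sigma_algebraType (past theta n.+1) -> R).
    apply: g_sigma_measurable_fun_le (IH j); exact: past_nondecreasing.
  have mth : measurable_fun setT
      (theta n : g_sigma_algebraType (past theta n.+1) -> borel_rV R d).
    move=> _ Y mY; rewrite setTI; apply: sub_sigma_algebra.
    exact: past_preimage.
  rewrite (_ : (fun _ => _) = fun w => X n w ord0 i +
      (r * edistance (X n w) (boundary V)) * sphere_part (theta n w) ord0 i).
    apply: measurable_funD; first exact: mX.
    apply: measurable_funM.
      apply: measurable_funM => //.
      exact: (@measurable_edistance _ _ _
        (g_sigma_algebraType (past theta n.+1))).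
    exact: (measurableT_comp (@measurable_sphere_part R d i) mth).
  by apply/funext => w; rewrite /X /= !mxE.
have X_cvg i : {ae P, forall w, cvg (X n w ord0 i @[n --> \oo])}.
  apply: (@bounded_martingale_cvg _ _ _ P (past theta)
    (fun n w => X n w ord0 i) C).
  - exact: past_measurable.
  - exact: past_nondecreasing.
  - by move=> n; exact: X_adapted.
  - by move=> n w; exact: VC.
  move=> n U mU [D UD].
  (* The product separates into a factor known from the past and an odd function of the new
     direction [theta n]. *)
  have E w : U w * (X n.+1 w ord0 i - X n w ord0 i) =
      U w * (r * edistance (X n w) (boundary V)) *
        sphere_part (theta n w) ord0 i.
    by rewrite /X /= !mxE addrAC subrr add0r mulrA.
  under eq_Rintegral do rewrite E.
  apply: (symmetric_noise_orthogonal theta_indep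
    (h := fun x : borel_rV R d => sphere_part x ord0 i)).
  - apply: measurable_funM => //; apply: measurable_funM => //.
    by apply: (@measurable_edistance _ _ _
      (g_sigma_algebraType (past theta n))).
  - exact: measurable_sphere_part.
  - move=> B mB; have mh := @measurable_sphere_part R d i.
    rewrite !law; first exact: uniform_sphere_part_symmetric.
      have /(_ measurableT B mB) : measurable_fun setT
          (fun x : borel_rV R d => - sphere_part x ord0 i).
        exact: measurableT_comp.
      by rewrite setTI.
    by have := mh measurableT B mB; rewrite setTI.
  (* By [E], the product is [U] times a difference of two coordinates, each bounded by [C]. *)
  - exists (D * (C + C)) => w; rewrite -E normrM ler_pM//.
    by rewrite (le_trans (ler_normB _ _))// lerD//; exact: VC.
have th_unit : {ae P, forall w, forall n, enorm (theta n w) = 1}.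
  apply: negligibleS (negligible_bigcup
    (F := fun n => theta n @^-1` ~` @unit_sphere R d) _).
    by move=> w /existsNP[n nw]; exists n.
  move=> n; exists (theta n @^-1` ~` @unit_sphere R d); split=> //.
    apply: measurable_funPTI; apply: measurableC; exact: unit_sphere_borel.
  transitivity (mu (~` @unit_sphere R d)).
    by apply: law; apply: measurableC; exact: unit_sphere_borel.
  rewrite probability_setC; last exact: unit_sphere_borel.
  by case: mu_uniform => -> _; rewrite subee.
have X_cvg_all : {ae P, forall w, forall i, cvg (X n w ord0 i @[n --> \oo])}.
  exact: filter_forall.
apply: filterS2 th_unit X_cvg_all => w th1 Xc.
(* Where all directions are unit vectors, [sphere_part] changes nothing and the original walk
   coincides with [X]. *)
have walkE n : walk V r v (fun n => theta n : Omega -> 'rV[R]_d) n w = X n w.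
  by elim: n => //= n ->; rewrite /X /= /th /sphere_part th1 eqxx.
have xc :
    cvg (walk V r v (fun n => theta n : Omega -> 'rV[R]_d) n w @[n --> \oo]).
  by under eq_fun do rewrite walkE; exact: cvg_rV.
by split => //; exact: walk_limit_boundary.
Qed.
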